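(* Let $k,m,n$ be positive integers with $m<n$ and $t(m+j)=t(n+j)$ for all $0\leqslant j\leqslant k$. Then $$k\ll n^{3/4}(\log n)^{3/2},$$ where the implied constant is absolute.
   Context: For $n\ge1$, $t(n)$ is the rooted planar tree of $n$: $t(1)$ is the single-vertex tree; if $n=p_1^{a_1}\cdots p_s^{a_s}$ with primes $p_1<\dots<p_s$ and $a_i\ge1$, then $t(n)$ is a root with $s$ edges ordered left to right, the $i$-th edge leading to a copy of $t(a_i)$. $f\ll g$ means $|f|\le Cg$. *)

(* Defs.v *)
From mathcomp Require Import all_boot.

Set Implicit Arguments.
Unset Strict Implicit.
Unset Printing Implicit Defensive.

(* Finite rooted planar trees: a root with its ordered (left to right) list of
   subtrees; [Node [::]] is the single-vertex tree. *)
Inductive ptree : Type := Node of seq ptree.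

(* [prime_decomp n] lists the pairs (p_i, a_i), a_i >= 1, by increasing primes
   p_i.  The first argument bounds the recursion depth; since a_i < n, the depth
   n used in [tree] is always enough, see [treeE]. *)
Fixpoint tree_rec (d n : nat) : ptree :=
  if d is d'.+1 then Node [seq tree_rec d' pa.2 | pa <- prime_decomp n]
  else Node [::].

Definition tree (n : nat) : ptree := tree_rec n n.

Lemma prime_decomp_exp_lt n pa : pa \in prime_decomp n -> pa.2 < n.
Proof.
case: (posnP n) => [->|n_gt0]; first by rewrite in_nil.
case: pa => p a /mem_prime_decomp[p_pr a_gt0 dvd_n] /=.
exact: leq_trans (ltn_expl a (prime_gt1 p_pr)) (dvdn_leq n_gt0 dvd_n).
Qed.

Lemma tree_rec_enough d n : n <= d -> tree_rec d n = tree n.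
Proof.
rewrite /tree; elim/ltn_ind: n d => n IHn d; case: n IHn => [|n] IHn.
  by case: d.
case: d => // d le_nd /=; congr Node; apply/eq_in_map => pa /prime_decomp_exp_lt.
rewrite ltnS => le_an.
by rewrite !IHn // (leq_trans le_an).
Qed.

Lemma treeE n : tree n = Node [seq tree pa.2 | pa <- prime_decomp n].
Proof.
case: n => // n; rewrite {1}/tree /=; congr Node.
apply/eq_in_map => pa /prime_decomp_exp_lt; rewrite ltnS => le_an.
exact: tree_rec_enough.
Qed.

Lemma tree1 : tree 1 = Node [::]. Proof. by []. Qed.

(* Main.v *)
(** The tree of [x] shows whether [x] is squarefree: all the subtrees at its root
    are single vertices exactly when all exponents are [1].  Let [p] be the least
    prime whose square does not divide [d = n - m].  Each [m + j] divisible by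
    [p^2] forces [n + j] to be divisible by [q^2] for some prime [q <> p], with
    [q <= sqrt (n + k)].  As the sum of the [1/q^2] is less than [3/4], this can
    hold for all such [j] only if [k << p^2 sqrt (n + k)].  Finally [d] is
    divisible by the squares of all primes below [p], so [p << d^(1/8)]: if there
    are [r] of these primes, then [p - 1 <= 4^r], whereas their product exceeds
    any fixed geometric progression in [r].  Hence [k << n^(3/4)]. *)

Require Import Defs.
From mathcomp Require Import all_boot all_order all_algebra.
From mathcomp Require Import reals exp.
From mathcomp Require Import zify ring lra.

Import Order.TTheory GRing.Theory Num.Theory.

(** * Square factors read off the tree *)

Definition leaf (t : ptree) : bool := let: Node s := t in nilp s.

Lemma leaf_treeE n : leaf (tree n) = (n <= 1).
Proof.
rewrite treeE /= /nilp size_map.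
case: n => [|[|n]] //; apply/negbTE; rewrite size_eq0; apply/eqP => nil_pd.
by have := prod_prime_decomp (isT : 0 < n.+2); rewrite nil_pd big_nil.
Qed.

Lemma square_dvd_of_tree_eq p x y :
    prime p -> 0 < x -> tree x = tree y -> p ^ 2 %| x ->
  exists2 q, prime q & q ^ 2 %| y.
Proof.
move=> p_pr x_gt0; rewrite [tree x]treeE [tree y]treeE => -[eqxy] p2x.
have lex : 1 < logn p x by rewrite -pfactor_dvdn.
have : has (fun t => ~~ leaf t) [seq tree pa.2 | pa <- prime_decomp x].
  rewrite has_map; apply/hasP; exists (p, logn p x).
    rewrite prime_decompE; apply/mapP; exists p => //.
    by rewrite mem_primes p_pr x_gt0 (dvdn_trans _ p2x) // dvdn_exp.
  by rewrite /= leaf_treeE -ltnNge.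
rewrite eqxy has_map => /hasP[[q a] qa /=]; rewrite leaf_treeE -ltnNge => a_gt1.
have [q_pr _ dvd_y] := mem_prime_decomp qa; exists q => //.
exact: dvdn_trans (dvdn_exp2l q a_gt1) dvd_y.
Qed.

(** * Integer square roots, and sieving a progression by squares *)

Lemma floor_sqrt_exists y : exists t, t ^ 2 <= y < t.+1 ^ 2.
Proof.
elim: y => [|y [t /andP[lt gt]]]; first by exists 0.
case: (ltnP y.+1 (t.+1 ^ 2)) => h; first by exists t; rewrite h; lia.
by exists t.+1; rewrite h /=; lia.
Qed.

(** As [Q] is coprime to [P], all these [i] lie in a single residue class modulo [Q], so the
    quotient [i %/ Q] determines [i]. *)
Lemma card_dvdn_affine_le Q P N K : 0 < Q -> coprime Q P ->
  #|[set i : 'I_K | Q %| N + P * i]| <= (K %/ Q).+1.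
Proof.
move=> Q_gt0 coQP; rewrite -[X in _ <= X]card_ord.
pose f (i : 'I_K) : 'I_(K %/ Q).+1 := inord (i %/ Q).
rewrite -(@card_in_imset _ _ f); first exact: max_card.
have lt_f (i : 'I_K) : i %/ Q < (K %/ Q).+1 by rewrite ltnS leq_div2r // ltnW.
move=> i j; rewrite !inE => Qi Qj /(congr1 val); rewrite /= !inordK // => eq_div.
have eq_mod : i = j %[mod Q].
  wlog le_ij : i j Qi Qj {eq_div} / i <= j.
    by move=> W; case/orP: (leq_total i j) => /W -> //.
  apply/eqP; rewrite eq_sym eqn_mod_dvd //.
  rewrite -(Gauss_dvdr _ coQP) mulnBr -(subnDl N).
  exact: dvdn_sub.
by apply/val_inj; rewrite /= (divn_eq i Q) (divn_eq j Q) eq_div eq_mod.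
Qed.

(* [1/q^2 <= 1/(q-1) - 1/q] telescopes from [q = 3] on. *)
Lemma sum_inv_square_le t :
  (\sum_(2 <= q < t.+3) (q%:R ^+ 2)^-1 <= 3 / 4 - (t.+2)%:R^-1 :> rat)%R.
Proof.
elim: t => [|t IHt]; first by rewrite big_nat1.
rewrite big_nat_recr //=.
have -> : (t.+3%:R = t.+2%:R + 1 :> rat)%R by rewrite -natr1.
have : (0 < t.+2%:R :> rat)%R by rewrite ltr0n.
move: IHt; set x : rat := (t.+2)%:R%R; set S := (\sum_(_ <= _ < _) _)%R.
move=> IHt x_gt0.
suff le_inv : (((x + 1) ^+ 2)^-1 <= x^-1 - (x + 1)^-1)%R.
  by rewrite (le_trans (lerD IHt le_inv)) // addrA subrK.
have -> : (x^-1 - (x + 1)^-1 = (x * (x + 1))^-1)%R by field; lra.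
by rewrite lef_pV2 ?posrE; nra.
Qed.

Lemma sum_divn_square_le K t : 4 * (\sum_(2 <= q < t.+1) K %/ q ^ 2) <= 3 * K.
Proof.
case: t => [|[|t]]; try by rewrite big_geq.
rewrite -(ler_nat rat) !natrM natr_sum.
suff : (\sum_(2 <= q < t.+3) (K %/ q ^ 2)%:R
         <= K%:R * \sum_(2 <= q < t.+3) (q%:R ^+ 2)^-1 :> rat)%R.
  have le34 : (\sum_(2 <= q < t.+3) (q%:R ^+ 2)^-1 <= 3 / 4 :> rat)%R.
    by rewrite (le_trans (sum_inv_square_le t)) // gerBl invr_ge0 ler0n.
  move=> /le_trans /(_ (ler_wpM2l (ler0n _ K) le34)) le_sum.
  by move: le_sum; set S := (\sum_(_ <= _ < _) _)%R; lra.
rewrite mulr_sumr big_nat [X in (_ <= X)%R]big_nat.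
apply: ler_sum => q /andP[q_ge2 _].
rewrite ler_pdivlMr; last by rewrite exprn_gt0 // ltr0n; lia.
by rewrite -natrX -natrM ler_nat leq_divM.
Qed.

(* If every [N + P i], [i < K], has a square factor [q^2] coprime to [P], the
   density [3/4 >= sum 1/q^2] of such [i] leaves only room for the rounding
   errors, at most one for each [q]. *)
Lemma square_sieve_bound P N K t :
    (forall i, i < K -> exists q,
       [/\ 1 < q, q <= t, coprime (q ^ 2) P & q ^ 2 %| N + P * i]) ->
  K <= 4 * t.
Proof.
move=> sieve.
pose A q :=
  [set i : 'I_K | (1 < q) && coprime (q ^ 2) P && (q ^ 2 %| N + P * i)].
have cover : [set: 'I_K] \subset \bigcup_(q < t.+1) A q.
  apply/subsetP => i _; have [q [q_gt1 le_qt co dvd]] := sieve i (ltn_ord i).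
  apply/bigcupP; exists (Ordinal (le_qt : q < t.+1)) => //.
  by rewrite inE /= q_gt1 co dvd.
have card_A q : #|A q| <= (if 1 < q then (K %/ q ^ 2).+1 else 0).
  have [/andP[q_gt1 co]|/negbTE bad] := boolP ((1 < q) && coprime (q ^ 2) P).
    rewrite q_gt1 (leq_trans _ (card_dvdn_affine_le _ _ N K _ co)) //; last by lia.
    by apply/subset_leq_card/subsetP => i; rewrite !inE => /andP[].
  by rewrite (_ : A q = set0) ?cards0 //; apply/setP => i; rewrite !inE bad.
have le_K : K <= \sum_(2 <= q < t.+1) (K %/ q ^ 2).+1.
  rewrite -[X in X <= _]card_ord -cardsT (leq_trans (subset_leq_card cover)) //.
  apply: leq_trans (_ : \sum_(q < t.+1) #|A q| <= _).
    elim/big_ind2: _ => [|x B y C leB leC|//]; first by rewrite cards0.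
    by rewrite (leq_trans (leq_card_setU _ _)) ?leq_add.
  apply: leq_trans
    (_ : \sum_(q < t.+1) (if 1 < q then (K %/ q ^ 2).+1 else 0) <= _).
    exact: leq_sum.
  rewrite -(big_mkord xpredT (fun q => if 1 < q then (K %/ q ^ 2).+1 else 0)).
  case: t {sieve cover} => [|t]; first by rewrite big_nat1 big_geq.
  rewrite big_nat_recl // big_nat_recl //= !add0n.
  by rewrite !big_add1.
(* Each [q] from [2] to [t] costs one rounding unit, so [K <= 3K/4 + t]. *)
have := sum_divn_square_le K t.
move: le_K; under eq_bigr do rewrite -add1n; rewrite big_split /= sum_nat_const_nat.
by lia.
Qed.

(** * The bound on [k] in terms of a prime [p] *)

Lemma exists_shift_dvdn P m : 0 < P -> exists2 j, j < P & P %| m + j.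
Proof.
move=> P_gt0; exists ((P - m %% P) %% P); first by rewrite ltn_mod.
rewrite /dvdn modnDmr -modnDml subnKC ?modnn //.
by rewrite ltnW // ltn_mod.
Qed.

Lemma tree_eq_window_bound k m n p :
    0 < m -> m < n -> prime p -> ~~ (p ^ 2 %| n - m) ->
    (forall j, j <= k -> tree (m + j) = tree (n + j)) ->
  k ^ 2 <= 25 * p ^ 4 * (n + k).
Proof.
move=> m_gt0 lt_mn p_pr ndvd eq_tree.
have P_gt0 : 0 < p ^ 2 by rewrite expn_gt0 prime_gt0.
have [j0 lt_j0 dvd_j0] := exists_shift_dvdn (p ^ 2) m P_gt0.
have [t /andP[le_t lt_t]] := floor_sqrt_exists (n + k).
(* The sieve runs over [j = j0 + p ^ 2 * i], where [p ^ 2] divides [m + j]; as [j0 < p ^ 2], at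
   least [k.+1 %/ p ^ 2] such terms are at most [k]. *)
have leK : k.+1 %/ p ^ 2 <= 4 * t.
  apply: (square_sieve_bound (p ^ 2) (n + j0)) => i lt_i.
  have le_j : j0 + p ^ 2 * i <= k.
    have := leq_divM k.+1 (p ^ 2).
    have : i.+1 * p ^ 2 <= k.+1 %/ p ^ 2 * p ^ 2 by rewrite leq_mul2r lt_i orbT.
    by rewrite mulSn (mulnC i); lia.
  have [||q q_pr dvd_q] := square_dvd_of_tree_eq p _ _ p_pr _ (eq_tree _ le_j).
  - by lia.
  - by rewrite addnA dvdn_add // dvdn_mulr.
  exists q; rewrite prime_gt1 // -addnA dvd_q; split=> //.
    have n_gt0 : 0 < n + (j0 + p ^ 2 * i) by lia.
    rewrite leqNgt; apply: contraL lt_t => lt_tq; rewrite -leqNgt.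
    rewrite (leq_trans (leq_trans _ (dvdn_leq n_gt0 dvd_q))) ?leq_sqr //.
    by rewrite leq_add2l.
  (* If [q = p], then [p ^ 2] divides both [n + j] and [m + j], hence [n - m]. *)
  rewrite coprimeXl // coprimeXr // prime_coprime // dvdn_prime2 //.
  apply: contra ndvd => /eqP eq_qp; rewrite -eq_qp.
  have -> : n - m = n + (j0 + p ^ 2 * i) - (m + (j0 + p ^ 2 * i)) by lia.
  by rewrite dvdn_sub // addnA dvdn_add ?eq_qp // dvdn_mulr.
have t_gt0 : 0 < t by case: t le_t lt_t {leK} => // _; rewrite exp1n; lia.
(* Here [k + 1 < (4t + 1) p^2 <= 5 t p^2], the last step by [t >= 1]. *)
have lt_k : k < 5 * (p ^ 2 * t).
  have := ltn_ceil k.+1 P_gt0.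
  have : (k.+1 %/ p ^ 2).+1 * p ^ 2 <= (5 * t) * p ^ 2.
    by rewrite leq_mul2r; apply/orP; right; lia.
  by rewrite -mulnA (mulnC t); lia.
have -> : 25 * p ^ 4 * (n + k) = (5 * p ^ 2) ^ 2 * (n + k).
  by rewrite expnMn -expnM.
apply: (@leq_trans ((5 * p ^ 2) ^ 2 * t ^ 2)); last by rewrite leq_mul2l le_t orbT.
by rewrite -expnMn leq_sqr -mulnA ltnW.
Qed.

(** * The size of the least prime whose square does not divide [d] *)

(* Erdos: a positive integer below [p] is a square times a product of distinct
   primes below [p]. *)
Lemma pred_le_exp4_card_primes p :
  p.-1 <= 4 ^ #|[set q : 'I_p | prime q]|.
Proof.
case: p => // y; set S := [set q : 'I_y.+1 | prime q] => /=.
have [t /andP[le_t lt_t]] := floor_sqrt_exists y.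
(* [Aa.1] will be the set of primes of odd exponent, and [Aa.2] the root of the square part, lowered
   by one to fit ['I_t]. *)
pose g (Aa : {set 'I_y.+1} * 'I_t) := (\prod_(q in Aa.1) val q) * Aa.2.+1 ^ 2.
have sub : {subset iota 1 y <= [seq g Aa | Aa in setX (powerset S) setT]}.
  move=> x; rewrite mem_iota add1n ltnS => /andP[x_gt0 le_xy].
  pose a := \prod_(q in S) val q ^ (logn q x)./2.
  pose A := [set q in S | odd (logn (val q) x)].
  have xE : x = (\prod_(q in A) val q) * a ^ 2.
    rewrite -{1}(partnT x_gt0) (widen_partn _ le_xy) big_mkord -mulnn.
    rewrite (big_mkcond (mem A)) /= /a (big_mkcond (mem S)) /= -!big_split /=.
    apply: eq_bigr => q _; rewrite !inE; case: (boolP (prime q)) => q_pr /=.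
      rewrite -{1}(odd_double_half (logn q x)) -addnn !expnD.
      by case: odd; rewrite ?expn1.
    by rewrite lognE (negbTE q_pr).
  have a_gt0 : 0 < a.
    by rewrite lt0n; apply: contraL x_gt0 => /eqP a0; rewrite xE a0 muln0.
  have lt_a : a.-1 < t.
    rewrite prednK // leqNgt; apply: contraL lt_t => lt_ta; rewrite -leqNgt.
    apply: leq_trans le_xy; rewrite xE (@leq_trans (a ^ 2)) ?leq_sqr //.
    rewrite leq_pmull //.
    by rewrite lt0n; apply: contraL x_gt0 => /eqP A0; rewrite xE A0.
  apply/imageP; exists (A, Ordinal lt_a); last by rewrite /g /= prednK.
  by rewrite !inE andbT /=; apply/subsetP => q; rewrite inE => /andP[].
have le_y : y <= 2 ^ #|S| * t.
  have := uniq_leq_size (iota_uniq 1 y) sub.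
  by rewrite size_iota size_image cardsX card_powerset cardsT card_ord.
(* With [r = #|S|], [y <= 2^r t] and [t^2 <= y] give [y^2 <= 4^r y]; a factor [y] cancels. *)
have := leq_mul le_y le_y.
have -> : 2 ^ #|S| * t * (2 ^ #|S| * t) = 4 ^ #|S| * t ^ 2.
  by rewrite mulnACA -expnMn mulnn.
move=> le_y2; case: y @S le_t {lt_t g sub le_y} le_y2 => // y S le_t le_y2.
by rewrite -(leq_pmul2r (ltn0Sn y)) (leq_trans le_y2) // leq_mul2l le_t orbT.
Qed.

(** A prime that is at least [B] pays for its own factor [B]; the fewer than [B] smaller primes are
    paid for by [B ^ B]. *)
Lemma exp_card_primes_le_primorial B p : 0 < B ->
  B ^ #|[set q : 'I_p | prime q]| <= B ^ B * \prod_(q < p | prime q) q.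
Proof.
move=> B_gt0; rewrite -prod_nat_const big_mkcond /=.
rewrite [X in _ * X]big_mkcond /=.
(* For the induction, [minn s B] counts the indices below both [s] and [B]. *)
suff le_s s : \prod_(q < s) (if prime q then B else 1)
    <= B ^ minn s B * \prod_(q < s) (if prime q then val q else 1).
  under eq_bigr do rewrite inE.
  rewrite (leq_trans (le_s p)) // leq_mul2r leq_pexp2l ?orbT // geq_minr //.
elim: s => [|s IHs]; first by rewrite !big_ord0 min0n.
rewrite !big_ord_recr /=; set X := \prod_(_ < _) _ in IHs *.
set Y := \prod_(_ < _) _ in IHs *.
case: ifP => s_pr; last first.
  rewrite !muln1 (leq_trans IHs) // leq_mul2r leq_pexp2l ?orbT //; lia.
case: (leqP B s) => le_Bs.
  rewrite (_ : minn s.+1 B = minn s B); last by lia.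
  by rewrite mulnA leq_mul.
rewrite (_ : minn s.+1 B = (minn s B).+1); last by lia.
rewrite expnS mulnC -mulnA leq_mul2l mulnA (leq_trans IHs) ?orbT //.
by rewrite leq_pmulr // prime_gt0.
Qed.

Lemma prod_prime_square_dvdn d p :
    (forall q, q < p -> prime q -> q ^ 2 %| d) ->
  (\prod_(q < p | prime q) q) ^ 2 %| d.
Proof.
elim: p => [|p IHp] sq_dvd; first by rewrite big_ord0 dvd1n.
rewrite big_mkcond big_ord_recr -big_mkcond /=.
have IH : (\prod_(q < p | prime q) q) ^ 2 %| d.
  by apply: IHp => q lt_qp; apply: sq_dvd; rewrite ltnW.
case: ifP => p_pr; last by rewrite muln1.
rewrite expnMn Gauss_dvd ?IH ?sq_dvd //.
rewrite coprimeXl // coprimeXr // coprime_sym.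
elim/big_rec: _ => [|q x q_pr co]; first exact: coprimen1.
by rewrite coprimeMr co andbT prime_coprime // dvdn_prime2 // neq_ltn ltn_ord orbT.
Qed.

(** Let [p] be the least such prime, [r] the number of smaller primes, and [B = 4^4]. Then
    [(p - 1)^8 <= 4^(8r) = B^(2r) <= B^(2B) d], as the squared product of the smaller primes divides
    [d]. *)
Lemma least_prime_square_not_dvdn :
  exists c, forall d, 0 < d ->
    exists p, [/\ prime p, ~~ (p ^ 2 %| d) & p ^ 8 <= c * d].
Proof.
have [B B_gt0 B2] : exists2 B, 0 < B & B ^ 2 = 4 ^ 8.
  by exists (4 ^ 4); [rewrite expn_gt0 | rewrite -expnM].
exists (2 ^ 8 * (B ^ B) ^ 2) => d d_gt0.
(* The square of a prime above [d] exceeds [d]. *)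
have exP : exists p, prime p && ~~ (p ^ 2 %| d).
  have [p lt_dp p_pr] := prime_above d; exists p; rewrite p_pr /=.
  apply/negP => /(dvdn_leq d_gt0); rewrite leqNgt (leq_trans lt_dp) //.
  by rewrite -mulnn leq_pmulr // prime_gt0.
case: (ex_minnP exP) => p /andP[p_pr ndvd] p_min; exists p; split=> //.
have le_d : (\prod_(q < p | prime q) q) ^ 2 <= d.
  apply: dvdn_leq => //; apply: prod_prime_square_dvdn => q lt_qp q_pr.
  apply: contraLR lt_qp => q_ndvd; rewrite -leqNgt p_min //.
  by rewrite q_pr.
have le_p : p <= 2 * p.-1 by have := prime_gt1 p_pr; lia.
have le_p8 : p ^ 8 <= 2 ^ 8 * p.-1 ^ 8 by rewrite -expnMn leq_exp2r.
apply: leq_trans le_p8 _; rewrite -mulnA; apply: leq_mul; first exact: leqnn.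
apply: leq_trans (_ : (4 ^ #|[set q : 'I_p | prime q]|) ^ 8 <= _).
  by rewrite leq_exp2r // pred_le_exp4_card_primes.
rewrite expnAC -B2 expnAC.
apply: leq_trans (_ : (B ^ B * \prod_(q < p | prime q) q) ^ 2 <= _).
  by rewrite leq_sqr exp_card_primes_le_primorial.
by rewrite expnMn leq_mul2l le_d orbT.
Qed.

(** * Eliminating [p] and taking the fourth root *)

Lemma tree_eq_window_pow4_bound :
  exists c, forall k m n, 0 < m -> m < n ->
    (forall j, j <= k -> tree (m + j) = tree (n + j)) -> k ^ 4 <= c * n ^ 3.
Proof.
have [c Hc] := least_prime_square_not_dvdn.
pose e := 25 ^ 2 * c * 4; exists (e + e ^ 2) => k m n m_gt0 lt_mn eq_tree.
have [|p [p_pr ndvd le_p]] := Hc (n - m); first by rewrite subn_gt0.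
have le_k2 := tree_eq_window_bound k m n p m_gt0 lt_mn p_pr ndvd eq_tree.
have n_gt0 : 0 < n := ltn_trans m_gt0 lt_mn.
have le_k4 : k ^ 4 <= 25 ^ 2 * c * n * (n + k) ^ 2.
  rewrite (_ : k ^ 4 = (k ^ 2) ^ 2); last by rewrite -expnM.
  apply: leq_trans (_ : (25 * p ^ 4 * (n + k)) ^ 2 <= _); first by rewrite leq_sqr.
  rewrite (expnMn _ (n + k)) (expnMn 25) -(expnM p) leq_mul2r -mulnA leq_mul2l.
  by rewrite (leq_trans le_p) ?orbT // leq_mul2l leq_subr orbT.
(* If [k <= n], then [(n + k)^2 <= 4 n^2], which gives [k^4 <= e n^3]. *)
have [le_kn|lt_nk] := leqP k n.
  apply: leq_trans (_ : e * n ^ 3 <= _); last by rewrite leq_mul2r leq_addr orbT.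
  apply: leq_trans le_k4 _; rewrite /e.
  rewrite -[X in _ <= X]mulnA -mulnA leq_mul2l; apply/orP; right.
  by rewrite [n ^ 3]expnS mulnCA leq_mul2l -(expnMn 2 n 2) leq_sqr; lia.
(* If [k > n], then [(n + k)^2 <= 4 k^2]; cancelling [k^2] leaves [k^2 <= e n], whose square
   accounts for the [e ^ 2] in the constant. *)
have le_k : k ^ 2 <= e * n.
  have k2_gt0 : 0 < k ^ 2 by rewrite expn_gt0; lia.
  rewrite -(leq_pmul2r k2_gt0) -expnD (leq_trans le_k4) // /e.
  rewrite -!mulnA !leq_mul2l; apply/orP; right; apply/orP; right.
  rewrite mulnCA leq_mul2l -(expnMn 2 k 2) leq_sqr; lia.
rewrite (_ : k ^ 4 = (k ^ 2) ^ 2); last by rewrite -expnM.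
apply: leq_trans (_ : (e * n) ^ 2 <= _); first by rewrite leq_sqr.
by rewrite expnMn leq_mul ?leq_addl // leq_pexp2l.
Qed.

Local Open Scope ring_scope.

Theorem theorem12 (R : realType) :
  exists C : R, forall k m n : nat,
    (0 < k)%N -> (0 < m)%N -> (m < n)%N ->
    (forall j : nat, (j <= k)%N -> tree (m + j)%N = tree (n + j)%N) ->
    k%:R <= C * (n%:R `^ (3 / 4) * (ln n%:R) `^ (3 / 2)).
Proof.
have [c Hc] := tree_eq_window_pow4_bound.
have L_gt0 : 0 < (ln 2 : R) `^ (3 / 2) by rewrite powR_gt0 // ln_gt0 // ltr1n.
(* The fourth root gives [c^(1/4) n^(3/4)]; as [n >= 2], the division by [(ln 2)^(3/2)] is offset by
   the logarithmic factor. *)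
exists (c%:R `^ (4^-1) / (ln 2) `^ (3 / 2)) => k m n _ m_gt0 lt_mn eq_tree.
have le_L : (ln 2 : R) `^ (3 / 2) <= (ln n%:R) `^ (3 / 2).
  have n_ge2 : (1 < n)%N by lia.
  rewrite ge0_ler_powR ?nnegrE ?ln_ge0 ?ler1n //; try lia; try lra.
  by rewrite ler_ln ?posrE ?ltr0n ?ler_nat //; lia.
have le_k : k%:R <= c%:R `^ (4^-1) * n%:R `^ (3 / 4) :> R.
  have -> : k%:R = (k ^ 4)%:R `^ (4^-1) :> R.
    by rewrite natrX -powR_mulrn ?ler0n // -powRrM divff ?pnatr_eq0 // powRr1 ?ler0n.
  have -> : n%:R `^ (3 / 4) = (n ^ 3)%:R `^ (4^-1) :> R.
    by rewrite natrX -powR_mulrn ?ler0n // -powRrM.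
  rewrite -powRM ?ler0n // -natrM ge0_ler_powR ?nnegrE ?invr_ge0 ?ler0n //.
  by rewrite ler_nat (Hc k m n).
rewrite (le_trans le_k) // mulrACA ler_peMr ?mulr_ge0 ?powR_ge0 //.
by rewrite mulrC ler_pdivlMr // mul1r.
Qed.
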